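(* Let $\mathfrak{B}$ be a bornology with a closed base on a topological space $X$, and let $X$ be a Lindelöf space. The following hold. (1) $X$ satisfies $U_{fin}(\mathcal{O},\mathcal{O}_{\mathfrak{B}})$ if and only if $X$ satisfies $U_{fin}(\Gamma,\mathcal{O}_{\mathfrak{B}})$. (2) $X$ satisfies $U_{fin}(\mathcal{O},\Gamma_{\mathfrak{B}})$ if and only if $X$ satisfies $U_{fin}(\Gamma,\Gamma_{\mathfrak{B}})$.
   Context: A bornology $\mathfrak{B}$ on $X$ is a family of subsets of $X$ that is closed under taking subsets and finite unions and covers $X$; by standing convention $X\notin\mathfrak{B}$. A base of $\mathfrak{B}$ is a subfamily $\mathfrak{B}_0\subseteq\mathfrak{B}$ such that every $B\in\mathfrak{B}$ is contained in some $B_0\in\mathfrak{B}_0$; it is closed if its members are closed subsets of $X$. $\mathcal{O}$ is the collection of all open covers of $X$. $\Gamma$ is the collection of all $\gamma$-covers of $X$: infinite open covers $\mathcal{U}$ such that for each $x\in X$ the set $\{U\in\mathcal{U}:x\notin U\}$ is finite. $\mathcal{O}_{\mathfrak{B}}$ is the collection of all open $\mathfrak{B}$-covers of $X$: families $\mathcal{U}$ of open subsets of $X$ with $X\notin\mathcal{U}$ such that every $B\in\mathfrak{B}$ is contained in some $U\in\mathcal{U}$. $\Gamma_{\mathfrak{B}}$ is the collection of all $\gamma_{\mathfrak{B}}$-covers of $X$: infinite covers $\mathcal{U}=\{U_n:n\in\omega\}$ of $X$ by proper open subsets such that for each $B\in\mathfrak{B}$ there is $n_0\in\omega$ with $B\subseteq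 U_n$ for all $n\ge n_0$. For collections $\mathcal{A},\mathcal{B}$ of families of subsets of $X$, $U_{fin}(\mathcal{A},\mathcal{B})$ means that for each sequence $\{\mathcal{U}_n:n\in\omega\}$ of elements of $\mathcal{A}$ there are finite (possibly empty) $\mathcal{V}_n\subseteq\mathcal{U}_n$ ($n\in\omega$) such that $\{\bigcup\mathcal{V}_n:n\in\omega\}\in\mathcal{B}$ or $\bigcup\mathcal{V}_n=X$ for some $n$. *)

(* Defs.v *)
From mathcomp Require Import all_boot all_order.
From mathcomp Require Import boolp classical_sets functions cardinality.
From mathcomp Require Import topology.

Set Implicit Arguments.
Unset Strict Implicit.
Unset Printing Implicit Defensive.

Local Open Scope classical_set_scope.

(* The last field is the standing convention that the bornology is not the
   trivial one, i.e. the whole space is not bounded. *)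
Record is_bornology (X : Type) (B : set_system X) : Prop := IsBornology {
  bornology_subset : forall A C : set X, A `<=` C -> B C -> B A;
  bornology_setU : forall A C : set X, B A -> B C -> B (A `|` C);
  bornology_cover : \bigcup_(A in B) A = setT;
  bornology_setTN : ~ B setT }.

Definition is_bornology_base (X : Type) (B B0 : set_system X) : Prop :=
  B0 `<=` B /\ forall A, B A -> exists2 A0, B0 A0 & A `<=` A0.

Definition has_closed_base (X : topologicalType) (B : set_system X) : Prop :=
  exists2 B0 : set_system X, is_bornology_base B B0 &
    forall A, B0 A -> closed A.

Definition open_covers (X : topologicalType) : set (set_system X) :=
  [set U | (forall W, U W -> open W) /\ \bigcup_(W in U) W = setT].

(* [countable] means finite or countably infinite. *)
Definition lindelof (X : topologicalType) : Prop :=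
  forall U : set_system X, open_covers U ->
    exists V : set_system X, [/\ V `<=` U, countable V & open_covers V].

Definition gamma_covers (X : topologicalType) : set (set_system X) :=
  [set U | [/\ open_covers U, infinite_set U &
    forall x : X, finite_set [set W | U W /\ ~ W x]]].

Definition open_B_covers (X : topologicalType) (B : set_system X) :
    set (set_system X) :=
  [set U | [/\ forall W, U W -> open W, ~ U setT &
    forall A, B A -> exists2 W, U W & A `<=` W]].

(* The enumeration [u] may have repetitions; the family [U] itself is infinite
   as a set of sets. *)
Definition gamma_B_covers (X : topologicalType) (B : set_system X) :
    set (set_system X) :=
  [set U | [/\ open_covers U, ~ U setT, infinite_set U &
    exists2 u : nat -> set X, U = range u &
      forall A, B A -> exists n0 : nat, forall n, n0 <= n -> A `<=` u n]].

Definition Ufin (X : Type) (P Q : set (set_system X)) : Prop :=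
  forall U : nat -> set_system X, (forall n, P (U n)) ->
    exists V : nat -> set_system X,
      (forall n, V n `<=` U n /\ finite_set (V n)) /\
      (Q (range (fun n => \bigcup_(W in V n) W)) \/
       exists n, \bigcup_(W in V n) W = setT).

(* Main.v *)
Require Import Defs.
From mathcomp Require Import all_boot all_order.
From mathcomp Require Import boolp classical_sets functions cardinality.
From mathcomp Require Import topology.

(** Both equivalences are instances of one fact: on a Lindelof space,
    [Ufin (gamma_covers X) Q] and [Ufin (open_covers X) Q] are equivalent for
    every target class [Q].

    Gamma-covers are open covers, and [Ufin] is antitone in its first argument,
    so one implication is immediate.  For the other, a countable subcover of an
    open cover gives an increasing sequence of finite unions covering [X].  If
    it reaches [X], then finitely many members of the cover have union [X], and
    the second alternative of [Ufin] holds.  Otherwise the finite unions form a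
    gamma-cover ([lindelof_finite_or_gamma]).  Finitely many members of that
    gamma-cover have the same union as finitely many members of the original
    cover ([unfold_finite_unions]), so a selection from the gamma-covers turns
    into a selection from the original covers with the very same sequence of
    unions; whatever [Q] says about that sequence is preserved. *)

Set Implicit Arguments.
Unset Strict Implicit.
Unset Printing Implicit Defensive.

Local Open Scope classical_set_scope.

Definition is_finite_union (X : Type) (U : set_system X) (W : set X) : Prop :=
  exists F : set_system X,
    [/\ F `<=` U, finite_set F & W = \bigcup_(A in F) A].

Lemma Ufin_antitone (X : Type) (P P' Q : set (set_system X)) :
  P `<=` P' -> Ufin P' Q -> Ufin P Q.
Proof. by move=> PP' selP' U PU; apply: selP' => n; exact: PP'. Qed.

Lemma unfold_finite_unions (X : Type) (U T : set_system X) :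
  finite_set T -> (forall W, T W -> is_finite_union U W) ->
  is_finite_union U (\bigcup_(W in T) W).
Proof.
move=> finT unionT.
have [F FP] : {F : set X -> set_system X & forall W, T W ->
    [/\ F W `<=` U, finite_set (F W) & W = \bigcup_(A in F W) A]}.
  apply: (@choice _ _ (fun W V => T W ->
    [/\ V `<=` U, finite_set V & W = \bigcup_(A in V) A])) => W.
  have [TW|nTW] := pselect (T W); last by exists set0.
  by have [V VP] := unionT _ TW; exists V.
exists (\bigcup_(W in T) F W); split.
- by move=> A [W TW FWA]; have [FU _ _] := FP _ TW; exact: FU.
- by apply: bigcup_finite => // W TW; have [] := FP _ TW.
- rewrite bigcup_bigcup; apply: eq_bigcupr => W TW.
  by have [_ _] := FP _ TW.
Qed.

(** A point misses only the terms before the first one that contains it.  The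
    range is infinite because otherwise monotonicity would make one term contain
    all the others, and that term would be [X]. *)
Lemma increasing_cover_gamma (X : topologicalType) (S : nat -> set X) :
  (forall k, open (S k)) -> (forall i j, i <= j -> S i `<=` S j) ->
  \bigcup_k S k = setT -> (forall k, S k <> setT) -> gamma_covers (range S).
Proof.
move=> openS incS coverS SNT; split.
- split; first by move=> _ [k _ <-].
  by rewrite bigcup_image.
- move=> finS; have [idx idxP] : {idx : set X -> nat &
      forall W, range S W -> S (idx W) = W}.
    apply: (@choice _ _ (fun W k => range S W -> S k = W)) => W.
    have [[k _ <-]|nSW] := pselect (range S W); first by exists k.
    by exists 0.
  have [N idxN] : exists N, forall k, idx (S k) <= N.
    have /finite_seqP[s sE] := finite_image idx finS.
    exists (\max_(i <- s) i) => k; apply: (@leq_bigmax_seq _ s xpredT id) => //.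
    by have : [set` s] (idx (S k)) by rewrite -sE; apply/imageP/imageT.
  apply: (SNT N); rewrite -subTset -coverS => x [k _ Skx].
  apply: (incS _ _ (idxN k)); rewrite idxP //; exact: imageT.
- move=> x; have [k _ Skx] : (\bigcup_k S k) x by rewrite coverS.
  apply: (@sub_finite_set _ _ (S @` `I_k)); last exact/finite_image/finite_II.
  move=> _ [[j _ <-] nSjx]; exists j => //=.
  by rewrite ltnNge; apply/negP => /incS /(_ _ Skx).
Qed.

(** The finite unions are indexed by bounding an injective code of the members
    of a countable subcover, so that a finite or empty subcover needs no
    separate treatment. *)
Lemma lindelof_finite_or_gamma (X : topologicalType) (U : set_system X) :
  lindelof X -> open_covers U ->
  is_finite_union U setT \/
  exists2 G, gamma_covers G & forall W, G W -> is_finite_union U W.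
Proof.
move=> lindX /lindX [V [VU /countable_injP [code injcode] [openV coverV]]].
pose F k := [set A | V A /\ code A <= k].
pose S k := \bigcup_(A in F k) A.
have unionS k : is_finite_union U (S k).
  exists (F k); split => //; first by move=> A [/VU].
  have injF : {in F k &, injective code}.
    by move=> A C /set_mem[VA _] /set_mem[VC _]; apply: injcode; exact/mem_set.
  rewrite -(eq_finite_set (inj_card_eq injF)).
  apply: (@sub_finite_set _ _ `I_k.+1); last exact: finite_II.
  by move=> _ [A [_ Ak] <-].
have [[k Sk]|nS] := pselect (exists k, S k = setT).
  by left; rewrite -Sk.
right; exists (range S); last by move=> _ [k _ <-].
apply: increasing_cover_gamma => [k|i j ij||k Sk].
- by apply: bigcup_open => A [/openV].
- by apply: bigcup_subset => A [VA Ai]; split=> //; exact: leq_trans ij.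
- rewrite -subTset -coverV => x [A VA Ax].
  by exists (code A) => //; exists A.
- by apply: nS; exists k.
Qed.

Lemma lindelof_Ufin_gamma (X : topologicalType) (Q : set (set_system X)) :
  lindelof X -> Ufin (@gamma_covers X) Q -> Ufin (@open_covers X) Q.
Proof.
move=> lindX selG U coverU.
have [[m [F [FU finF FT]]]|nfin] :=
    pselect (exists n, is_finite_union (U n) setT).
  exists (fun n => if n == m then F else set0); split; last first.
    by right; exists m; rewrite eqxx.
  by move=> n; case: eqP => [->|_]; split.
have [G GP] : {G : nat -> set_system X & forall n, gamma_covers (G n) /\
    forall W, G n W -> is_finite_union (U n) W}.
  apply: (@choice _ _ (fun n H => gamma_covers H /\
    forall W, H W -> is_finite_union (U n) W)) => n.
  have [Ufin_n|[H gH HU]] := lindelof_finite_or_gamma lindX (coverU n).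
    by case: nfin; exists n.
  by exists H.
have [T [TP QT]] := selG G (fun n => (GP n).1).
have /choice[V VP] n : is_finite_union (U n) (\bigcup_(W in T n) W).
  have [TG finT] := TP n; apply: unfold_finite_unions => // W /TG.
  exact: (GP n).2.
exists V; split; first by move=> n; have [] := VP n.
have <- : (fun n => \bigcup_(W in T n) W) = (fun n => \bigcup_(W in V n) W).
  by apply/funext => n; have [] := VP n.
case: QT => [QT|[n Tn]]; [by left|right; exists n].
by have [_ _ <-] := VP n.
Qed.

Theorem theorem3p9 (X : topologicalType) (B : set_system X)
    (bornB : is_bornology B) (closedB : has_closed_base B)
    (lindelofX : lindelof X) :
  (Ufin (@open_covers X) (open_B_covers B) <->
   Ufin (@gamma_covers X) (open_B_covers B)) /\
  (Ufin (@open_covers X) (gamma_B_covers B) <->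
   Ufin (@gamma_covers X) (gamma_B_covers B)).
Proof.
have equivQ Q : Ufin (@open_covers X) Q <-> Ufin (@gamma_covers X) Q.
  split; last exact: lindelof_Ufin_gamma.
  by apply: Ufin_antitone => U [].
by split.
Qed.
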